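(* Let $(D,\dashv,\vdash,\alpha)$ be a Hom-dialgebra. Define a bilinear map $[-,-]\colon D^{\otimes2}\to D$ by $$[x,y]=x\dashv y-y\vdash x .$$ Then $(D,[-,-],\alpha)$ is a Hom-Leibniz algebra.
   Context: $\mathbb{K}$ is a field of characteristic $0$; modules, $\otimes$, $\operatorname{End}$ are over $\mathbb{K}$. A Hom-dialgebra is a tuple $(D,\dashv,\vdash,\alpha)$ with $D$ a $\mathbb{K}$-module, $\dashv,\vdash\colon D^{\otimes2}\to D$ bilinear, $\alpha\in\operatorname{End}(D)$ linear, such that for all $x,y,z\in D$ $$\alpha(x)\dashv(y\dashv z)=(x\dashv y)\dashv\alpha(z)=\alpha(x)\dashv(y\vdash z),\qquad (x\vdash y)\dashv\alpha(z)=\alpha(x)\vdash(y\dashv z),$$ $$(x\dashv y)\vdash\alpha(z)=\alpha(x)\vdash(y\vdash z)=(x\vdash y)\vdash\alpha(z).$$ A Hom-Leibniz algebra is a triple $(L,[-,-],\alpha)$ with $L$ a $\mathbb{K}$-module, $[-,-]\colon L^{\otimes2}\to L$ bilinear and $\alpha\in\operatorname{End}(L)$ linear, such that for all $x,y,z\in L$ $$[[x,y],\alpha(z)]=[[x,z],\alpha(y)]+[\alpha(x),[y,z]].$$ *)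

(* Defs.v *)
From HB Require Import structures.
From mathcomp Require Import all_boot all_algebra.

Set Implicit Arguments.
Unset Strict Implicit.
Unset Printing Implicit Defensive.

Import GRing.Theory.
Local Open Scope ring_scope.

Definition bilinear_op (K : fieldType) (M : lmodType K) (m : M -> M -> M) :
  Prop := bilinear_for *:%R *:%R m.

(* [l] is the left product "dashv" and [r] the right product "vdash".
   The twisting map [alpha] is linear, but not assumed multiplicative. *)
Record is_hom_dialgebra (K : fieldType) (D : lmodType K)
    (l r : D -> D -> D) (alpha : D -> D) : Prop := IsHomDialgebra {
  hdialg_bilinear_l : bilinear_op l;
  hdialg_bilinear_r : bilinear_op r;
  hdialg_linear : linear alpha;
  hdialg_ll : forall x y z, l (alpha x) (l y z) = l (l x y) (alpha z);
  hdialg_lr : forall x y z, l (l x y) (alpha z) = l (alpha x) (r y z);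
  hdialg_rl : forall x y z, l (r x y) (alpha z) = r (alpha x) (l y z);
  hdialg_rr : forall x y z, r (l x y) (alpha z) = r (alpha x) (r y z);
  hdialg_rr' : forall x y z, r (alpha x) (r y z) = r (r x y) (alpha z)
}.

Record is_hom_leibniz (K : fieldType) (L : lmodType K)
    (br : L -> L -> L) (alpha : L -> L) : Prop := IsHomLeibniz {
  hleib_bilinear : bilinear_op br;
  hleib_linear : linear alpha;
  hleib_identity : forall x y z,
    br (br x y) (alpha z) = br (br x z) (alpha y) + br (alpha x) (br y z)
}.

Definition dialgebra_bracket (K : fieldType) (D : lmodType K)
  (l r : D -> D -> D) (x y : D) : D := l x y - r y x.

(* Main.v *)
Require Import Defs.
From HB Require Import structures.
From mathcomp Require Import all_boot all_algebra.

Import GRing.Theory.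
Local Open Scope ring_scope.

(** Expanding all brackets gives twelve products. The dialgebra axioms reduce each to a left-nested
    [l (l _ _) (alpha _)] or to an [r (alpha _) _]. The Leibniz right-hand side then has eight
    terms: four match the left-hand side, and the other four cancel in pairs. *)

Section BilinearOp.

Context {K : fieldType} {M : lmodType K} {m : M -> M -> M}.
Context (bilm : bilinear_op m).

Lemma bilinear_opPl a x y z : m (a *: x + y) z = a *: m x z + m y z.
Proof. by case: bilm => + _; apply. Qed.

Lemma bilinear_opPr a x y z : m z (a *: x + y) = a *: m z x + m z y.
Proof. by case: bilm => _; apply. Qed.

Lemma bilinear_opBl x y z : m (x - y) z = m x z - m y z.
Proof. by rewrite addrC -scaleN1r bilinear_opPl scaleN1r addrC. Qed.

Lemma bilinear_opBr x y z : m z (x - y) = m z x - m z y.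
Proof. by rewrite addrC -scaleN1r bilinear_opPr scaleN1r addrC. Qed.

End BilinearOp.

Lemma bilinear_dialgebra_bracket (K : fieldType) (D : lmodType K)
    (l r : D -> D -> D) :
  bilinear_op l -> bilinear_op r -> bilinear_op (dialgebra_bracket l r).
Proof.
move=> bl br; split=> z a x y; rewrite /dialgebra_bracket /=.
  by rewrite (bilinear_opPl bl) (bilinear_opPr br) scalerBr opprD addrACA.
by rewrite (bilinear_opPr bl) (bilinear_opPl br) scalerBr opprD addrACA.
Qed.

Theorem proposition5p5 (K : fieldType) (charK0 : [pchar K]%R =i pred0)
    (D : lmodType K) (l r : D -> D -> D) (alpha : D -> D) :
  is_hom_dialgebra l r alpha ->
  is_hom_leibniz (dialgebra_bracket l r) alpha.
Proof.
case=> bl br lin_alpha ll lr rl rr rr'.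
split=> [||x y z]; [exact: bilinear_dialgebra_bracket | exact: lin_alpha |].
rewrite /dialgebra_bracket.
rewrite !(bilinear_opBl bl, bilinear_opBr bl).
rewrite !(bilinear_opBl br, bilinear_opBr br).
(* The axioms serve as rewrite rules towards these normal forms. Reversed, [lr] turns
   [l (alpha x) (r z y)] into [l (l x z) (alpha y)], so that it cancels the first term of the
   bracket of [[x, z]] with [alpha y]. *)
rewrite ll !rl !rr -!rr' -[l (alpha x) (r z y)]lr.
(* The permutation puts the four terms of the left-hand side first, in their order, then the
   opposite pairs [l (l x z) (alpha y)] (1, 6) and [r (alpha y) (r z x)] (3, 8). *)
rewrite !opprB !addrA [RHS](ACl (5*4*7*2*1*6*3*8))/=.
by rewrite !addrK.
Qed.
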